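(* The set of bipartite sum basic equilibria is the set of complete bipartite graphs $K_{r,s}$ with $r,s\ge 1$; that is, a bipartite graph $G$ is a sum basic equilibrium if and only if $G$ is (isomorphic to) a complete bipartite graph $K_{r,s}$ for some integers $r,s\ge 1$. Therefore, the diameter of every bipartite sum basic equilibrium graph is at most $2$.
   Context: Graphs are finite, simple and undirected. For a graph $G$ and a vertex $u$, let $D_G(u)=\sum_{v\ne u} d_G(u,v)$ if $G$ is connected and $D_G(u)=\infty$ otherwise, where $d_G$ is the graph distance. A deviation in $u$ is any swap of an edge $uv\in E(G)$ for an edge $uv'$, where $v'\neq u,v$ is any other node of $G$; the deviated graph $G'$ is the graph obtained after applying the swap, i.e. the graph on $V(G)$ with edge set $(E(G)\setminus\{uv\})\cup\{uv'\}$. The cost difference of the deviation is $D_{G'}(u)-D_G(u)$. A connected graph $G$ is a sum basic equilibrium if and only if for every vertex $u$ of $G$ the cost difference of every possible deviation in $u$ is non-negative. $K_{r,s}$ denotes the complete bipartite graph with parts of sizes $r$ and $s$.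
   Formalization: The characterization is stated for graphs with at least two vertices, because the one-vertex graph is bipartite and vacuously a sum basic equilibrium but is not K_{r,s} with r,s ≥ 1; the diameter bound is stated without this restriction. *)

(* Defs.v *)
From HB Require Import structures.
From mathcomp Require Import all_boot all_order all_algebra.
From mathcomp Require Import constructive_ereal.

Set Implicit Arguments.
Unset Strict Implicit.
Unset Printing Implicit Defensive.

Import Order.TTheory GRing.Theory Num.Theory.

(* A finite simple undirected graph is a symmetric irreflexive e : rel T on a
   finType T; the definitions below take an arbitrary relation, symmetry and
   irreflexivity being hypotheses of the theorems. *)

Section Graph.
Variables (T : finType) (e : rel T).

Definition connected : bool := [forall x, forall y, connect e x y].

Definition walk (n : nat) (x y : T) : bool :=
  [exists p : n.-tuple T, path e x p && (last x p == y)].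

(* A shortest walk has no repeated vertex, so its length is less than #|T|.
   When x and y are not joined by a walk the value is the dummy #|T|; gdist is
   used below on connected graphs only. *)
Definition gdist (x y : T) : nat :=
  \big[minn/#|T|]_(n < #|T| | walk n x y) n.

Definition diameter : nat := \max_(x : T) \max_(y : T) gdist x y.

Definition total_dist (u : T) : \bar int :=
  if connected then ((\sum_(v | v != u) gdist u v)%:Z%:E)%E else +oo%E.

Definition bipartite : Prop :=
  exists A : {set T}, forall x y, e x y -> (x \in A) != (y \in A).

Definition swap_edge (u v v' : T) : rel T :=
  [rel x y | e x y && ([set x; y] != [set u; v])
             || ([set x; y] == [set u; v'])].

End Graph.

Lemma swap_edge_sym (T : finType) (e : rel T) u v v' :
  symmetric e -> symmetric (swap_edge e u v v').
Proof. by move=> sym_e x y; rewrite /swap_edge /= sym_e [[set y; x]]setUC. Qed.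

Lemma swap_edge_irr (T : finType) (e : rel T) u v v' :
  irreflexive e -> v' != u -> irreflexive (swap_edge e u v v').
Proof.
move=> irr_e v'u x; rewrite /swap_edge /= irr_e setUid /=.
apply/eqP=> /(congr1 (fun A : {set T} => #|A|)).
by rewrite cards1 cards2 eq_sym v'u.
Qed.

(* For connected e the subtrahend is finite, so the extended difference is
   never of the form +oo - +oo. *)
Definition cost_diff (T : finType) (e : rel T) (u v v' : T) : \bar int :=
  (total_dist (swap_edge e u v v') u - total_dist e u)%E.

Definition sum_basic_equilibrium (T : finType) (e : rel T) : Prop :=
  connected e /\
  forall u v v' : T, e u v -> v' != u -> v' != v ->
    (0 <= cost_diff e u v v')%E.

Definition complete_bipartite (r s : nat) : rel ('I_r + 'I_s) :=
  fun x y => match x, y with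
             | inl _, inr _ | inr _, inl _ => true
             | _, _ => false
             end.

Definition isomorphic (T U : finType) (e : rel T) (e' : rel U) : Prop :=
  exists2 f : T -> U, bijective f & forall x y, e x y = e' (f x) (f y).

(* Main.v *)
Require Import Defs.
From HB Require Import structures.
From mathcomp Require Import all_boot all_order all_algebra.
From mathcomp Require Import constructive_ereal.
From mathcomp Require Import zify.

Set Implicit Arguments.
Unset Strict Implicit.
Unset Printing Implicit Defensive.

(** The swaps that matter join a vertex a to a neighbour c of its neighbour b:
   replace ab by ac.  Fix a target w and call y a parent of x when y is a
   neighbour of x one step closer to w.  In a bipartite graph distances to w
   differ by exactly one along an edge, so the swap brings a closer to w exactly
   when b is a parent of a and c a parent of b; it takes a at most one step away
   from w, and only when b is the unique parent of a and c is not a parent of b.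
   At an equilibrium there are at most as many targets of the first kind as of
   the second ([swap_next]).

   Let P be a set of vertices each having at least two neighbours in P, and for
   b in P let k, l and l1 count, within P, the parents of b, its children, and
   its children with no parent other than b; thus k + l is the degree D of b in
   P.  The inequality summed over all ordered pairs (a, c) of neighbours of b
   reads: sum_w k l <= sum_w l1 (l - 1), that is,
   sum_w k (l + l1) <= (D - 1) sum_w l1 ([swap_sum]).  The left-hand summand is
   at least D - 1 whenever k = 1, so sum_w [k = 1] <= sum_w l1 for every b.  On
   the other hand, for each w every vertex counted by some l1 has exactly one
   parent, whence sum_b l1 <= sum_b [k = 1] ([sum_l1]).  So all these are
   equalities, and k (l + l1) = (D - 1) [k = 1] for every b and w ([core_eq]): a
   vertex with a parent has no child depending on it alone, and a vertex with
   two parents has no child.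

   If the graph has no leaf, P can be the whole vertex set, and these two facts
   rule out distance 3 ([dist_le2_no_leaf]).  A leaf prefers its own neighbour
   to every other vertex, so all leaves hang at the same vertex p; with P the set
   of vertices that are not leaves, distance 3 is again impossible
   ([dist_le2_leaf]).  A connected bipartite graph of diameter at most 2 is
   complete bipartite.

   Conversely, in a complete bipartite graph the total distance of u is
   2 (n - 1) - deg u, the least possible for a vertex of that degree, and a swap
   at u does not raise the degree of u. *)

(** * Walks and distances *)

Section Distance.
Variables (T : finType) (e : rel T).
Implicit Types (x y z w : T) (n m : nat).

Lemma walk0 x y : walk e 0 x y = (x == y).
Proof.
apply/existsP/eqP=> [[p]|->]; first by rewrite tuple0 /= => /eqP.
by exists [tuple]; rewrite /= eqxx.
Qed.

Lemma walkS n x y : walk e n.+1 x y = [exists z, e x z && walk e n z y].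
Proof.
apply/existsP/existsP=> [[p]|[z /andP[exz /existsP[p /andP[pp lp]]]]].
  case/tupleP: p => z p /= /andP[/andP[exz pp] lp].
  by exists z; rewrite exz /=; apply/existsP; exists p; rewrite pp.
by exists (cons_tuple z p); rewrite /= exz pp.
Qed.

Lemma walk_cons n x y z : e x z -> walk e n z y -> walk e n.+1 x y.
Proof.
by move=> exz wzy; rewrite walkS; apply/existsP; exists z; rewrite exz.
Qed.

Lemma walk_connect n x y : walk e n x y -> connect e x y.
Proof. by case/existsP=> p /andP[pp /eqP<-]; apply/connectP; exists p. Qed.

(** Shortening a path to a duplicate-free one bounds its length. *)
Lemma connect_walk x y :
  connect e x y -> exists2 n : nat, n < #|T| & walk e n x y.
Proof.
case/connectP=> p0 pp0 ->{y}; case/shortenP: pp0 => p pp up _.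
exists (size p).
  by have := max_card (mem (x :: p)); rewrite (card_uniqP up).
by apply/existsP; exists (in_tuple p); rewrite /= pp /=.
Qed.

Lemma gdist_le n x y : walk e n x y -> gdist e x y <= n.
Proof.
move=> wxy; rewrite /gdist.
have le_idx (r : seq 'I_#|T|) (P : pred 'I_#|T|) :
    \big[minn/#|T|]_(i <- r | P i) i <= #|T|.
  by elim: r => [|i r IH]; rewrite ?big_nil // big_cons; case: ifP; lia.
have [n_lt | n_ge] := ltnP n #|T|; last exact: leq_trans (le_idx _ _) n_ge.
have: Ordinal n_lt \in index_enum 'I_#|T| by apply: mem_index_enum.
elim: (index_enum _) => // i r IH; rewrite big_cons inE => /orP[/eqP<-|/IH] /=.
  by rewrite wxy geq_minl.
by case: ifP => // _; lia.
Qed.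

Lemma gdist_dummy_or_walk x y :
  gdist e x y = #|T| \/ walk e (gdist e x y) x y.
Proof.
rewrite /gdist; elim/big_ind: _ => //=; [by left | | by right].
by move=> a b; case: (leqP a b).
Qed.

Lemma gdist_walk x y : connect e x y -> walk e (gdist e x y) x y.
Proof.
case/connect_walk=> n n_lt wxy.
have lt_T : gdist e x y < #|T| by apply: leq_ltn_trans n_lt; apply: gdist_le.
by case: (gdist_dummy_or_walk x y) => // d_eq; rewrite d_eq ltnn in lt_T.
Qed.

Lemma gdist_ge x y : y != x -> 2 - e x y <= gdist e x y.
Proof.
move=> yx; case: (gdist_dummy_or_walk x y) => [->|].
  suff: 1 < #|T| by case: e => /=; lia.
  have := max_card (mem [set y; x]); by rewrite cards2 yx.
case: (gdist e x y) => [|[|n]] //; first by rewrite walk0 eq_sym (negbTE yx).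
  by rewrite walkS => /existsP[z /andP[exz]]; rewrite walk0 => /eqP <-; rewrite exz.
by move=> _; case: (e x y).
Qed.

Lemma gdistC x y : symmetric e -> connect e x y -> gdist e x y = gdist e y x.
Proof.
move=> sym_e cxy; have cyx : connect e y x by rewrite (sym_connect_sym sym_e).
have walkC n z t : walk e n z t -> walk e n t z.
  case/existsP=> p /andP[pp /eqP<-]; apply/existsP.
  have size_r : size (rev (belast z p)) == n.
    by rewrite size_rev size_belast size_tuple.
  exists (Tuple size_r); rewrite /= rev_path (eq_path (e' := e)) => [|a b] //.
  by rewrite pp; case: (tval p) => //= a s; rewrite rev_cons last_rcons.
by apply/eqP; rewrite eqn_leq !gdist_le //; apply/walkC/gdist_walk.
Qed.

End Distance.

(** * Swaps in an equilibrium *)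

Section Swaps.
Variables (T : finType) (e : rel T).
Hypothesis sym_e : symmetric e.
Implicit Types (x y z w u v : T) (n m : nat).

Lemma swap_edge_new u v v' : swap_edge e u v v' u v'.
Proof. by rewrite /swap_edge /= eqxx orbT. Qed.

Lemma swap_edge_away u v v' x y :
  x != u -> y != u -> e x y -> swap_edge e u v v' x y.
Proof.
move=> xu yu exy; rewrite /swap_edge /= exy /=; apply/orP; left.
apply/eqP=> /setP/(_ u); rewrite !inE eqxx /= (eq_sym u x) (eq_sym u y).
by rewrite (negbTE xu) (negbTE yu).
Qed.

Lemma swap_edge_old u v v' y :
  y != u -> y != v -> e u y -> swap_edge e u v v' u y.
Proof.
move=> yu yv euy; rewrite /swap_edge /= euy /=; apply/orP; left.
apply/eqP=> /setP/(_ y); rewrite !inE eqxx orbT.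
by rewrite (negbTE yu) (negbTE yv).
Qed.

(** If every vertex w can be reached from u within f w steps after the swap of
   uv for uv', then the deviated graph is connected and f bounds the new
   distances. *)
Lemma swap_cost (f : T -> nat) u v v' :
  sum_basic_equilibrium e -> e u v -> v' != u -> v' != v ->
  (forall w, exists2 n, n <= f w & walk (swap_edge e u v v') n u w) ->
  \sum_(w | w != u) gdist e u w <= \sum_(w | w != u) f w.
Proof.
move=> [conn_e eq_e] euv v'u v'v reach.
have := eq_e _ _ _ euv v'u v'v; rewrite /cost_diff /total_dist conn_e.
have sym_s := swap_edge_sym u v v' sym_e.
have conn_u w : connect (swap_edge e u v v') u w.
  by have [n _] := reach w; apply: walk_connect.
have -> : connected (swap_edge e u v v').
  apply/forallP=> x; apply/forallP=> y.
  by apply: connect_trans (conn_u y); rewrite (sym_connect_sym sym_s).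
rewrite -EFinN -EFinD lee_fin => le_D.
apply: (@leq_trans (\sum_(w | w != u) gdist (swap_edge e u v v') u w)).
  by move: le_D; lia.
apply: leq_sum => w _; have [n le_n walk_n] := reach w.
exact: leq_trans (gdist_le walk_n) le_n.
Qed.

(** A swap at u does not increase the degree of u. *)
Lemma swap_degree u v v' : e u v -> v != u -> v' != u ->
  \sum_(w | w != u) swap_edge e u v v' u w <= \sum_(w | w != u) e u w.
Proof.
move=> euv vu v'u; rewrite [X in _ <= X](bigD1 v) //= euv.
rewrite (bigD1 v') //= swap_edge_new leq_add2l.
rewrite big_mkcond [X in _ <= X]big_mkcond /=; apply: leq_sum => w _.
have [->|wu] //= := eqVneq w u; have [->|wv'] //= := eqVneq w v'.
have -> : swap_edge e u v v' u w = (w != v) && e u w.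
  rewrite /swap_edge /= orbC; case: eqP => [/setP/(_ w)|_] /=.
    by rewrite !inE eqxx orbT (negbTE wu) (negbTE wv').
  rewrite andbC; congr (~~ _ && _); apply/eqP/eqP=> [/setP/(_ w)|-> //].
  by rewrite !inE eqxx orbT (negbTE wu) => /esym/eqP.
by case: (w != v).
Qed.

End Swaps.

(** * Comparing sums *)

(** If pointwise F <= G and the sums compare the other way, F and G agree. *)
Lemma eq_of_leq_sum (I : finType) (Q : pred I) (F G : I -> nat) :
  (forall i, Q i -> F i <= G i) -> \sum_(i | Q i) G i <= \sum_(i | Q i) F i ->
  forall i, Q i -> F i = G i.
Proof.
move=> leFG leGF i Qi; apply/eqP; rewrite eqn_leq leFG //=.
move: leGF; rewrite (bigD1 i) // [X in _ <= X](bigD1 i) //= => leGF.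
have: \sum_(j | Q j && (j != i)) F j <= \sum_(j | Q j && (j != i)) G j.
  by apply: leq_sum => j /andP[/leFG].
by lia.
Qed.

Lemma sum_bool (I : finType) (A : {pred I}) (p : pred I) :
  \sum_(i in A) (p i : nat) = #|[set i in A | p i]|.
Proof. by rewrite -sum1dep_card big_mkcondr. Qed.

(** * Parents toward a vertex *)

Section Bipartite.
Variables (T : finType) (e : rel T).
Hypotheses (sym_e : symmetric e) (irr_e : irreflexive e).
Hypotheses (conn_e : connected e) (bip_e : bipartite e).
Implicit Types (x y z w a b c : T) (n m : nat).

Local Notation d := (gdist e).

(** [par x y w]: the neighbour y of x lies on a shortest path from x to w. *)
Definition par x y w := e x y && ((d y w).+1 == d x w).

(** [upar x y w]: every shortest path from x to w starts with the edge xy. *)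
Definition upar x y w := par x y w && [forall z, par x z w ==> (z == y)].

Lemma conn_all x y : connect e x y.
Proof. by have /forallP/(_ x)/forallP/(_ y) := conn_e. Qed.

Lemma edge_neq x y : e x y -> x != y.
Proof. by apply: contraTneq => ->; rewrite irr_e. Qed.

Lemma dist0 x y : (d x y == 0) = (x == y).
Proof.
apply/eqP/eqP=> [d0|->].
  by apply/eqP; rewrite -(walk0 e) -d0; apply: gdist_walk; apply: conn_all.
by apply/eqP; rewrite -leqn0 gdist_le // walk0.
Qed.

Lemma distxx x : d x x = 0.
Proof. by apply/eqP; rewrite dist0. Qed.

Lemma dist_edge x y w : e x y -> d x w <= (d y w).+1.
Proof.
by move=> exy; apply/gdist_le/(walk_cons exy)/gdist_walk/conn_all.
Qed.

Lemma dist_pred x w : x != w -> exists y, par x y w.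
Proof.
move=> xw; have := gdist_walk (conn_all x w).
case def_d: (d x w) => [|n]; first by rewrite walk0 (negbTE xw).
rewrite walkS => /existsP[y /andP[exy wy]]; exists y.
by rewrite /par exy def_d eqSS eqn_leq (gdist_le wy) -ltnS -def_d dist_edge.
Qed.

(** Along a walk in a bipartite graph the sides alternate, so its length has
   the parity forced by its endpoints. *)
Lemma dist_neq x y w : e x y -> d x w != d y w.
Proof.
have [A sideA] := bip_e => exy.
have odd_d z : odd (d z w) = ((z \in A) != (w \in A)).
  have: walk e (d z w) z w by apply/gdist_walk/conn_all.
  move: (d z w) => n; elim: n z => [|n IH] z.
    by rewrite walk0 => /eqP->; rewrite eqxx.
  rewrite walkS => /existsP[t /andP[/sideA zt /IH /= ->]].
  by move: zt; do 3!case: (_ \in A).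
apply: contraTneq (sideA _ _ exy) => eq_d.
have := odd_d y; rewrite -eq_d odd_d.
by do 3!case: (_ \in A).
Qed.

Lemma parVpar x y w : e x y -> ~~ par x y w -> par y x w.
Proof.
move=> exy; have eyx : e y x by rewrite sym_e.
have := dist_neq w exy; have := dist_edge w exy; have := dist_edge w eyx.
by rewrite /par exy eyx /=; lia.
Qed.

Lemma par_edge x y w : par x y w -> e x y.
Proof. by case/andP. Qed.

Lemma par_dist x y w : par x y w -> d x w = (d y w).+1.
Proof. by case/andP=> _ /eqP. Qed.

Lemma par_asym x y w : par x y w -> ~~ par y x w.
Proof. by move/par_dist=> dx; apply/negP=> /par_dist; lia. Qed.

Lemma par_neq x y w : par x y w -> x != w.
Proof. by move/par_dist; apply: contra_eq_neq => ->; rewrite distxx. Qed.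

Lemma dist1 x y : e x y -> d x y = 1.
Proof.
move=> exy; have := dist_edge y exy; rewrite distxx.
by have := dist0 x y; rewrite (negbTE (edge_neq exy)); lia.
Qed.

Lemma par_end x y : e x y -> par x y y.
Proof. by move=> exy; rewrite /par exy distxx dist1. Qed.

Lemma upar_par a b w : upar a b w -> par a b w.
Proof. by case/andP. Qed.

Lemma upar_uniq a b c w : upar a b w -> par a c w -> c = b.
Proof. by case/andP=> _ /forallP/(_ c)/implyP H /H /eqP. Qed.

(** When b is not the only parent of a, another parent exists. *)
Lemma not_upar a b w :
  a != w -> ~~ upar a b w -> exists2 z, par a z w & z != b.
Proof.
move=> /dist_pred[z paz] nab; have [zb|zb] := eqVneq z b; last by exists z.
move: nab; rewrite /upar -zb paz /= negb_forall => /existsP[t].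
by rewrite negb_imply => /andP[pat tz]; exists t.
Qed.

(** A shortest path to w starting at x is not destroyed by a swap at a vertex
   which is at least as far from w as x. *)
Lemma walk_swap u v v' x w :
  x != u -> d x w <= d u w -> walk (swap_edge e u v v') (d x w) x w.
Proof.
move def_n: (d x w) => n; elim: n x def_n => [|n IH] x def_n xu le_n.
  by rewrite walk0 -dist0 def_n.
have [|y pxy] := @dist_pred x w; first by rewrite -dist0 def_n.
have dy := par_dist pxy; have yu : y != u by apply: contraTneq le_n => <-; lia.
apply: (@walk_cons _ _ _ _ _ y); last by apply: IH => //; lia.
exact: swap_edge_away (par_edge pxy).
Qed.

Section Equilibrium.
Hypothesis eq_e : sum_basic_equilibrium e.

(** The vertices that a gets closer to by swapping ab for ac, where c is
   another neighbour of b, are those with b and c as the next two vertices on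
   some shortest path from a; the vertices that a moves away from all have b
   as their only first step, and the detour through c costs one.  At an
   equilibrium the former are therefore at most as many as the latter. *)
Lemma swap_next a b c : e a b -> e b c -> a != c ->
  \sum_w (par a b w && par b c w) <= \sum_w (upar a b w && ~~ par b c w).
Proof.
move=> eab ebc ac.
pose gain w : nat := par a b w && par b c w.
pose loss w : nat := upar a b w && ~~ par b c w.
suff: \sum_w gain w <= \sum_w loss w by [].
have ca : c != a by rewrite eq_sym.
have cb : c != b by rewrite eq_sym; apply: edge_neq.
have ba : b != a by rewrite eq_sym; apply: edge_neq.
have ecb : e c b by rewrite sym_e.
have := @swap_cost _ _ sym_e (fun w => d a w + loss w - gain w) _ _ _
   eq_e eab ca cb.
have gain_le w : gain w <= d a w.
  by rewrite /gain; case pab: (par a b w) => //=; rewrite (par_dist pab); case: par.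
have at_a : par a b a = false by rewrite /par distxx andbF.
have sum_gain : \sum_w gain w = \sum_(w | w != a) gain w.
  by rewrite (bigD1 a) //= /gain at_a.
have sum_loss : \sum_w loss w = \sum_(w | w != a) loss w.
  by rewrite (bigD1 a) //= /loss /upar at_a.
have -> : \sum_(w | w != a) (d a w + loss w - gain w)
    = \sum_(w | w != a) d a w + \sum_w loss w - \sum_w gain w.
  rewrite sum_gain sum_loss -big_split -sumnB // => w _.
  by have := gain_le w; rewrite /=; lia.
have: \sum_w gain w <= \sum_(w | w != a) d a w.
  by rewrite sum_gain; apply: leq_sum.
move=> le_gain reach; suff: \sum_(w | w != a) d a w <=
   \sum_(w | w != a) d a w + \sum_w loss w - \sum_w gain w.
  by move: le_gain; lia.
apply: reach => w; rewrite /gain /loss.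
have [->|wa] := eqVneq w a.
  by exists 0; rewrite ?walk0.
have [pbc|npbc] := boolP (par b c w); rewrite ?andbF ?andbT ?addn0 ?subn0.
  have [pab|npab] := boolP (par a b w); rewrite /= ?subn0 ?subn1.
    (* gain: a goes straight to c *)
    exists (d c w).+1; first by rewrite (par_dist pab) (par_dist pbc).
    apply: walk_cons (swap_edge_new _ _ _ _) (walk_swap _ _ ca _).
    by rewrite (par_dist pab) (par_dist pbc) -addn2 leq_addr.
  exists (d a w) => //; have [|y pay] := @dist_pred a w; first by rewrite eq_sym.
  rewrite (par_dist pay).
  have yb : y != b by apply: contraNneq npab => <-.
  have ya : y != a by rewrite eq_sym edge_neq // (par_edge pay).
  apply: walk_cons (swap_edge_old _ ya yb (par_edge pay)) (walk_swap _ _ ya _).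
  by rewrite (par_dist pay) leqnSn.
have [uab|nuab] := boolP (upar a b w); rewrite /= ?addn1 ?addn0.
  (* loss: b is still within reach of a, through c *)
  have pab := upar_par uab; exists (d b w).+2; first by rewrite (par_dist pab).
  apply: walk_cons (swap_edge_new _ _ _ _) _.
  apply: walk_cons (swap_edge_away _ _ ca ba ecb) (walk_swap _ _ ba _).
  by rewrite (par_dist pab) leqnSn.
have [|y pay yb] := not_upar _ nuab; first by rewrite eq_sym.
exists (d a w) => //; rewrite (par_dist pay).
have ya : y != a by rewrite eq_sym edge_neq // (par_edge pay).
apply: walk_cons (swap_edge_old _ ya yb (par_edge pay)) (walk_swap _ _ ya _).
by rewrite (par_dist pay) leqnSn.
Qed.
(** * Counting parents and children inside a set of minimum degree two *)

Section Core.
Variable P : {set T}.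
Hypothesis P_deg : forall b, b \in P -> 1 < #|[set x in P | e b x]|.

(* Within P: the neighbours of b, then its parents, its children, and its
   children whose only parent (in the whole graph) is b. *)
Let nb b := [set x in P | e b x].
Let k b w := #|[set c in P | par b c w]|.
Let l b w := #|[set a in P | par a b w]|.
Let l1 b w := #|[set a in P | upar a b w]|.

Lemma nb_split b w : #|nb b| = k b w + l b w.
Proof.
rewrite /k /l -cardsUI [X in _ + X]eq_card0 ?addn0 => [|x]; last first.
  by rewrite !inE; apply/negP=> /andP[/andP[_ /par_asym/negbTE->]]; rewrite andbF.
apply: eq_card => x; rewrite !inE -andb_orr; congr (_ && _).
apply/idP/orP=> [ebx|[/par_edge //|/par_edge]]; last by rewrite sym_e.
by have [|/(parVpar ebx)] := boolP (par b x w); [left | right].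
Qed.

Lemma l1_le_l b w : l1 b w <= l b w.
Proof.
by apply/subset_leq_card/subsetP=> a; rewrite !inE => /andP[-> /upar_par->].
Qed.

(** Sum of the swap inequality over all ordered pairs (a, c) of neighbours of
   b.  A target w contributes k l to the left-hand side and l1 (l - 1) to the
   right-hand side; k l1 is then added to both. *)
Lemma swap_sum b :
  \sum_w k b w * (l b w + l1 b w) <= #|nb b|.-1 * \sum_w l1 b w.
Proof.
have split_w : forall w, l1 b w * (l b w).-1 + k b w * l1 b w
    = #|nb b|.-1 * l1 b w.
  move=> w; rewrite (nb_split b w); have := l1_le_l b w.
  case: (l b w) => [|m]; first by rewrite leqn0 => /eqP->; rewrite !muln0.
  by rewrite addnS /= mulnDl addnC [m * _]mulnC.
suff le_kl : \sum_w k b w * l b w <= \sum_w l1 b w * (l b w).-1.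
  rewrite big_distrr /= -(eq_bigr _ (fun w _ => split_w w)) big_split /=.
  rewrite -(eq_bigr _ (fun w _ => esym (mulnDr (k b w) _ _))) big_split /=.
  by rewrite leq_add2r.
pose pairs (F : T -> T -> T -> nat) :=
  \sum_(a in nb b) \sum_(c in nb b | c != a) \sum_w F a c w.
apply: (@leq_trans (pairs (fun a c w => upar a b w && ~~ par b c w))).
  have -> : \sum_w k b w * l b w
      = pairs (fun a c w => (par a b w && par b c w) : nat).
    rewrite /pairs; under [RHS]eq_bigr do rewrite exchange_big.
    rewrite exchange_big; apply: eq_bigr => w _ /=.
    have -> : l b w = #|[set a in nb b | par a b w]|.
      apply: eq_card => a; rewrite !inE -andbA; congr (_ && _).
      by apply/idP/andP=> [p|[]//]; rewrite sym_e (par_edge p).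
    rewrite -sum_bool big_distrr /=; apply: eq_bigr => a _.
    have [pab|] := boolP (par a b w); last by rewrite muln0 big1.
    rewrite muln1 /k -sum1dep_card [RHS]big_mkcond [LHS]big_mkcond /=.
    apply: eq_bigr => c _; rewrite !inE; case: (c \in P) => //=.
    have [pbc|] := boolP (par b c w); last by case: ifP.
    rewrite (par_edge pbc) /=; case: eqP => // ca.
    by move: (par_asym pab); rewrite -ca pbc.
  apply: leq_sum => a; rewrite inE => /andP[_ eba].
  apply: leq_sum => c; rewrite inE => /andP[/andP[_ ebc] ca].
  by apply: swap_next => //; rewrite 1?sym_e 1?eq_sym.
rewrite /pairs; under eq_bigr do rewrite exchange_big.
rewrite exchange_big; apply: leq_sum => w _ /=.
have -> : l1 b w = #|[set a in nb b | upar a b w]|.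
  apply: eq_card => a; rewrite !inE -andbA; congr (_ && _).
  by apply/idP/andP=> [p|[]//]; rewrite sym_e (par_edge (upar_par p)).
rewrite -sum_bool big_distrl /=; apply: leq_sum => a; rewrite inE => /andP[aP _].
have [uab|] := boolP (upar a b w); last by rewrite big1.
rewrite mul1n /= /l (cardsD1 a) inE aP (upar_par uab) /=.
rewrite -big_mkcondr sum1dep_card subset_leq_card //.
apply/subsetP=> c; rewrite !inE -!andbA => /and4P[-> ebc -> np].
exact: parVpar.
Qed.

(** Each vertex counted on the left has a single parent, and is counted for
   that parent only. *)
Lemma sum_l1 w : \sum_(b in P) l1 b w <= \sum_(b in P) (k b w == 1).
Proof.
rewrite /l1; under eq_bigr do rewrite -sum_bool.
rewrite exchange_big; apply: leq_sum => a _; rewrite sum_bool.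
have [->|] := eqVneq [set b in P | upar a b w] set0; first by rewrite cards0.
case/set0Pn=> b; rewrite inE => /andP[bP uab].
have -> : [set b in P | upar a b w] = [set b].
  apply/setP=> c; rewrite !inE; apply/andP/eqP=> [[_ /upar_par]|->] //.
  exact: upar_uniq.
rewrite cards1 /k.
suff -> : [set c in P | par a c w] = [set b] by rewrite cards1.
apply/setP=> c; rewrite !inE; apply/andP/eqP=> [[_]|->].
  exact: upar_uniq.
by rewrite bP upar_par.
Qed.

(** Summing the pointwise bound over w gives one inequality for each b, and
   [sum_l1] gives the reverse inequality for the sums over b; hence equality
   everywhere. *)
Lemma core_eq b w : b \in P ->
  k b w * (l b w + l1 b w) = #|nb b|.-1 * (k b w == 1).
Proof.
have pointwise c u : #|nb c|.-1 * (k c u == 1) <= k c u * (l c u + l1 c u).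
  by rewrite (nb_split c u); case: eqP => [->|] /=; lia.
have per_b c : c \in P -> \sum_u (k c u == 1) <= \sum_u l1 c u.
  move=> cP; have deg_c := P_deg cP; rewrite -/(nb c) in deg_c.
  rewrite -(@leq_pmul2l #|nb c|.-1); last by lia.
  apply: leq_trans (swap_sum c); rewrite big_distrr.
  by apply: leq_sum => u _; apply: pointwise.
have total : \sum_(c in P) \sum_u l1 c u <= \sum_(c in P) \sum_u (k c u == 1).
  rewrite exchange_big [X in _ <= X]exchange_big.
  by apply: leq_sum => u _; apply: sum_l1.
move=> bP; have eq_b := eq_of_leq_sum per_b total bP.
apply/esym.
apply: (@eq_of_leq_sum _ predT (fun u => #|nb b|.-1 * (k b u == 1))
  (fun u => k b u * (l b u + l1 b u))) => //.
by rewrite -big_distrr /= eq_b; apply: swap_sum.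
Qed.

(** A vertex with a parent has no child depending on it alone. *)
Lemma no_upar_of_par a b c w : a \in P -> b \in P -> c \in P ->
  par b c w -> upar a b w -> False.
Proof.
move=> aP bP cP pbc uab; have := core_eq w bP; rewrite (nb_split b w).
have : 0 < k b w by apply/card_gt0P; exists c; rewrite inE cP.
have : 0 < l1 b w by apply/card_gt0P; exists a; rewrite inE aP.
by case: eqP => [->|]; nia.
Qed.

(** A vertex with a child has at most one parent. *)
Lemma par_unique_of_child a b c c' w : a \in P -> b \in P -> c \in P -> c' \in P ->
  par a b w -> par b c w -> par b c' w -> c = c'.
Proof.
move=> aP bP cP c'P pab pbc pbc'; apply/eqP; apply: contraPT (core_eq w bP).
move=> cc'.
have : 1 < k b w by apply/card_gt1P; exists c, c'; rewrite !inE cP c'P.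
have : 0 < l b w by apply/card_gt0P; exists a; rewrite inE aP.
by case: eqP => [->|] //; nia.
Qed.

End Core.

(** * Distances in a bipartite equilibrium *)

Lemma swap_next_card a b c : e a b -> e b c -> a != c ->
  #|[set w | par a b w && par b c w]|
    <= #|[set w | upar a b w && ~~ par b c w]|.
Proof.
by move=> eab ebc ac; have := swap_next eab ebc ac; rewrite !(sum_bool predT).
Qed.

(** Without leaves, P can be the whole vertex set.  On a shortest path
   x, y, z, ... to w of length at least 3, z has a parent, so it is not the only
   parent of y; but y has the child x, so it has only one parent. *)
Lemma dist_le2_no_leaf x w :
  (forall b, 1 < #|[set y | e b y]|) -> d x w <= 2.
Proof.
move=> deg2; rewrite leqNgt; apply/negP=> far.
have degT b : b \in [set: T] -> 1 < #|[set y in [set: T] | e b y]|.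
  move=> _; apply: leq_trans (deg2 b) (eq_leq _).
  by apply: eq_card => y; rewrite !inE.
have [|y pxy] := @dist_pred x w; first by rewrite -dist0; lia.
have dx := par_dist pxy.
have [|z pyz] := @dist_pred y w; first by rewrite -dist0; lia.
have dy := par_dist pyz.
have [|t pzt] := @dist_pred z w; first by rewrite -dist0; lia.
have [uyz|nuyz] := boolP (upar y z w).
  by apply: (no_upar_of_par degT _ _ _ pzt uyz); rewrite inE.
have [z' pyz' /eqP[]] := not_upar (par_neq pyz) nuyz.
by apply: (par_unique_of_child degT _ _ _ _ pxy pyz' pyz); rewrite inE.
Qed.

(** The vertices of degree at least 2.  In a connected graph with at least two
   vertices, the vertices outside [inner] are the leaves. *)
Definition inner := [set x | 1 < #|[set y | e x y]|].

Lemma leaf_nb x y z : x \notin inner -> e x y -> e x z -> y = z.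
Proof.
rewrite inE -leqNgt => /card_le1_eqP le1 exy exz.
by apply: le1; rewrite inE.
Qed.

Lemma leaf_par v p w : v \notin inner -> e v p -> v != w -> par v p w.
Proof.
move=> leaf_v evp /dist_pred[y pvy].
by rewrite (leaf_nb leaf_v evp (par_edge pvy)).
Qed.

Lemma leaf_dist v p x : v \notin inner -> e v p -> x != v -> d x v = (d x p).+1.
Proof.
move=> leaf_v evp xv; rewrite !(gdistC sym_e (conn_all x _)).
by apply/par_dist/leaf_par; rewrite // eq_sym.
Qed.

(** A shortest path between two other vertices avoids a leaf v, hence survives
   a swap at v. *)
Lemma walk_swap_leaf v q q' x w : v \notin inner -> x != v -> w != v ->
  walk (swap_edge e v q q') (d x w) x w.
Proof.
move=> leaf_v; move def_n: (d x w) => n.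
elim: n x def_n => [|n IH] x def_n xv wv.
  by rewrite walk0 -dist0 def_n.
have [|y pxy] := @dist_pred x w; first by rewrite -dist0 def_n.
have yv : y != v.
  apply/eqP=> yv; rewrite yv in pxy.
  move: (par_asym pxy); rewrite leaf_par // 1?eq_sym // sym_e.
  exact: par_edge pxy.
have dy := par_dist pxy; apply: (@walk_cons _ _ _ _ _ y).
  exact: swap_edge_away (par_edge pxy).
by apply: IH => //; lia.
Qed.

(** A leaf prefers its own neighbour to any other vertex, so that neighbour
   minimizes the total distance among the vertices other than the leaf, and is
   the only one to do so. *)
Lemma leaf_center v p q : v \notin inner -> e v p -> q != v -> q != p ->
  \sum_w d p w < \sum_w d q w.
Proof.
move=> leaf_v evp qv qp.
have := @swap_cost _ _ sym_e (fun w => (d q w).+1) _ _ _ eq_e evp qv qp.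
have reach w : exists2 n, n <= (d q w).+1 & walk (swap_edge e v p q) n v w.
  have [->|wv] := eqVneq w v; first by exists 0; rewrite ?walk0.
  exists (d q w).+1 => //.
  by apply: walk_cons (swap_edge_new _ _ _ _) (walk_swap_leaf _ _ _ _ _).
move/(_ reach); have pv : p != v by rewrite eq_sym edge_neq.
have -> : \sum_(w | w != v) d v w = \sum_(w | w != v) (d p w).+1.
  by apply: eq_bigr => w wv; apply/par_dist/leaf_par; rewrite // eq_sym.
under eq_bigr do rewrite -addn1; rewrite big_split /=.
under [X in _ <= X -> _]eq_bigr do rewrite -addn1.
rewrite big_split /= leq_add2r => le_pq.
rewrite (bigD1 v) // [X in _ < X](bigD1 v) //= !(leaf_dist leaf_v evp) //.
rewrite distxx; have : 0 < d q p by rewrite lt0n dist0.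
by lia.
Qed.

Lemma leaf_nb_eq v p v' p' : v \notin inner -> v' \notin inner ->
  p \in inner -> p' \in inner -> e v p -> e v' p' -> p = p'.
Proof.
move=> leaf_v leaf_v' pP p'P evp evp'; apply/eqP; apply: contraT => pp'.
have pv' : p != v' by apply: contraNneq leaf_v' => <-.
have p'v : p' != v by apply: contraNneq leaf_v => <-.
have := leaf_center leaf_v evp p'v; rewrite eq_sym pp' => /(_ isT).
have := leaf_center leaf_v' evp' pv' pp'.
by lia.
Qed.

Lemma leaf_nb_inner v p x w :
  2 < d x w -> v \notin inner -> e v p -> p \in inner.
Proof.
move=> far leaf_v evp; apply: contraT => leaf_p.
have epv : e p v by rewrite sym_e.
have all_vp y : (y == v) || (y == p).
  apply: contraT; rewrite negb_or => /andP[yv yp].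
  have pvy : par v p y by apply: leaf_par; rewrite // eq_sym.
  by have := par_asym pvy; rewrite (leaf_par leaf_p epv) // eq_sym.
case/orP: (all_vp x) far => /eqP->; case/orP: (all_vp w) => /eqP->;
  by rewrite ?distxx ?dist1.
Qed.

(** Suppose that some distance exceeds 2.  All leaves hang at one vertex p.
   Take a neighbour c of p which is not a leaf, and another neighbour x of c.
   Swapping xc for xp brings x closer to p and to every leaf.  If p has two
   neighbours in [inner], then [inner] can serve as P, so x moves away from c
   only.  If c is the only one, then the swap of vp for vc at the leaf v bounds
   the number of vertices of [inner] in terms of the number of leaves, and too
   few are left for x to move away from. *)
Lemma dist_le2_leaf v x0 w0 : v \notin inner -> d x0 w0 <= 2.
Proof.
move=> leaf_v; rewrite leqNgt; apply/negP=> far.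
have nb_ex x : exists y, e x y.
  have [xw|xw] := eqVneq x w0.
    have [|y /par_edge exy] := @dist_pred x x0; last by exists y.
    by rewrite xw -dist0 gdistC ?conn_all //; lia.
  by have [y /par_edge exy] := dist_pred xw; exists y.
have [p evp] := nb_ex v.
have pP : p \in inner by apply: leaf_nb_inner far leaf_v evp.
have leaf_p u : u \notin inner -> e u p.
  move=> leaf_u; have [q euq] := nb_ex u.
  by rewrite (leaf_nb_eq leaf_v leaf_u pP _ evp euq) // (leaf_nb_inner far leaf_u).
have nb_inner b y : b \in inner -> b != p -> e b y -> y \in inner.
  move=> bP bp eby; apply: contraR bp => leaf_y; apply/eqP.
  by apply: (leaf_nb leaf_y); rewrite ?leaf_p // sym_e.
have deg_inner b : b \in inner -> b != p -> 1 < #|[set y in inner | e b y]|.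
  move=> bP bp; move: (bP); rewrite inE => /leq_trans; apply.
  apply/subset_leq_card/subsetP=> y; rewrite [in X in X -> _]inE => eby.
  by rewrite inE eby (nb_inner b).
have inner_leaf b u : b \in inner -> u \notin inner -> b != u.
  by move=> bP; apply: contraNneq => <-.
have [c cP epc] : exists2 c, c \in inner & e p c.
  have [c /andP[]|no_c] := pickP (fun c => (c \in inner) && e p c).
    by exists c.
  (* Otherwise the graph is a star with centre p. *)
  have near y : d p y <= 1.
    have [->|py] := eqVneq p y; first by rewrite distxx.
    have [z ppz] := dist_pred py; have epz := par_edge ppz.
    have leaf_z : z \notin inner by have := no_c z; rewrite epz andbT => ->.
    have [<-|zy] := eqVneq z y; first by rewrite dist1.
    have pzp : par z p y by apply: leaf_par; rewrite // sym_e.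
    by have := par_asym ppz; rewrite pzp.
  have [x0p|x0p] := eqVneq p x0; first by have := near w0; rewrite x0p; lia.
  have : d p x0 = 1.
    by have := near x0; have := dist0 p x0; rewrite (negbTE x0p); lia.
  move=> d1; have [y] := dist_pred x0p.
  move=> ppy; have := par_dist ppy; rewrite d1 => -[/esym/eqP].
  rewrite dist0 => /eqP yx; have ex0p : e x0 p by rewrite sym_e -yx (par_edge ppy).
  by have := dist_edge w0 ex0p; have := near w0; lia.
have ecp : e c p by rewrite sym_e.
have cp : c != p by apply: edge_neq.
have [x ecx xp] : exists2 x, e c x & x != p.
  have := cP; rewrite inE => /card_gt1P[y [z [ey ez yz]]].
  rewrite !inE in ey ez; have [yp|yp] := eqVneq y p; last by exists y.
  by exists z; rewrite // -yp eq_sym.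
have exc : e x c by rewrite sym_e.
have xP : x \in inner := nb_inner _ _ cP cp ecx.
have gain_x : p |: ~: inner \subset [set w | par x c w && par c p w].
  have gain_p : par x c p && par c p p.
    rewrite par_end // andbT; apply: (parVpar ecx); apply/negP=> /par_dist.
    by rewrite (dist1 ecp) => -[/esym/eqP]; rewrite dist0 (negbTE xp).
  apply/subsetP=> u; rewrite in_setU1 in_setC [in X in _ -> X]in_set.
  case/orP=> [/eqP->|leaf_u] //.
  by move: gain_p; rewrite /par !(leaf_dist leaf_u (leaf_p _ leaf_u)) ?inner_leaf.
have card_pL : #|p |: ~: inner| = (#|~: inner|).+1 by rewrite cardsU1 in_setC pP.
have := swap_next_card exc ecp xp.
have := subset_leq_card gain_x; rewrite card_pL => le_gain le_loss.
have : 0 < #|~: inner| by apply/card_gt0P; exists v; rewrite inE.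
(* Does p have two neighbours in inner, or only c? *)
have [deg_p|deg_p] := ltnP 1 #|[set y in inner | e p y]|.
  have degP b : b \in inner -> 1 < #|[set y in inner | e b y]|.
    by have [->|bp /deg_inner] := eqVneq b p; last exact.
  have : [set w | upar x c w && ~~ par c p w] \subset [set c].
    apply/subsetP=> w; rewrite !inE => /andP[uxc _]; rewrite eq_sym.
    apply: contraT => /dist_pred[y pcy].
    by case: (no_upar_of_par degP xP cP _ pcy uxc); apply: nb_inner (par_edge pcy).
  move/subset_leq_card; rewrite cards1 => le1.
  by have := leq_trans le_gain (leq_trans le_loss le1); rewrite ltnS leqn0 => /eqP->.
have vc : v != c by rewrite eq_sym inner_leaf.
have gain_v : inner :\ p \subset [set w | par v p w && par p c w].
  apply/subsetP=> w; rewrite !in_setD1 => /andP[wp wP]; rewrite inE.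
  rewrite leaf_par //=; last by rewrite eq_sym inner_leaf.
  have [|y ppy] := @dist_pred p w; first by rewrite eq_sym.
  have epy := par_edge ppy.
  have [yP|leaf_y] := boolP (y \in inner).
    by have -> : c = y by apply: (card_le1_eqP deg_p); rewrite in_set ?cP ?yP.
  have pyp : par y p w.
    by apply: leaf_par; rewrite ?leaf_p // eq_sym inner_leaf.
  by have := par_asym ppy; rewrite pyp.
have loss_v :
    [set w | upar v p w && ~~ par p c w] \subset (p |: ~: inner) :\ v.
  apply/subsetP=> w; rewrite inE => /andP[uvp npc].
  rewrite in_setD1 eq_sym (par_neq (upar_par uvp)) in_setU1 in_setC /=.
  rewrite -implyNb; apply/implyP=> wp.
  apply: contra npc => wP; suff: w \in inner :\ p.
    by move/(subsetP gain_v); rewrite inE => /andP[].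
  by rewrite in_setD1 wp wP.
have loss_x :
    [set w | upar x c w && ~~ par c p w] \subset (inner :\ p) :\ x.
  apply/subsetP=> w; rewrite inE => /andP[uxc ncp].
  rewrite in_setD1 eq_sym (par_neq (upar_par uxc)) in_setD1 /=.
  have: w \notin p |: ~: inner.
    by apply: contra ncp => /(subsetP gain_x); rewrite inE => /andP[].
  by rewrite in_setU1 in_setC negb_or negbK.
have le_x := leq_trans le_gain (leq_trans le_loss (subset_leq_card loss_x)).
have le_v := leq_trans (subset_leq_card gain_v)
  (leq_trans (swap_next_card evp epc vc) (subset_leq_card loss_v)).
have card_v : #|~: inner| = #|(p |: ~: inner) :\ v|.
  apply/eq_add_S; rewrite -card_pL (cardsD1 v (p |: _)).
  by rewrite in_setU1 in_setC leaf_v orbT.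
move: le_v; rewrite -card_v (cardsD1 x) in_setD1 xp xP leqNgt.
by rewrite add1n ltnS (ltnW le_x).
Qed.

Lemma bip_eq_dist_le2 x w : d x w <= 2.
Proof.
have [/forallP all_in|] := boolP [forall v, v \in inner].
  by apply: dist_le2_no_leaf => b; have := all_in b; rewrite inE.
by rewrite negb_forall => /existsP[v /dist_le2_leaf]; apply.
Qed.

End Equilibrium.

End Bipartite.

(** * Complete bipartite graphs *)

(** [two_sided A e]: e joins exactly the pairs with one vertex in A and one
   outside A. *)
Definition two_sided (T : finType) (A : {set T}) (e : rel T) :=
  forall x y, e x y = ((x \in A) != (y \in A)).

Lemma dist_le2_two_sided (T : finType) (e : rel T) (A : {set T}) :
  irreflexive e -> connected e ->
  (forall x y, e x y -> (x \in A) != (y \in A)) ->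
  (forall x y, gdist e x y <= 2) -> two_sided A e.
Proof.
move=> irr_e conn_e side le2 x y; apply/idP/idP=> [/side //|xy].
have cxy : connect e x y by have /forallP/(_ x)/forallP/(_ y) := conn_e.
have := le2 x y; have := gdist_walk cxy.
case: gdist => [|[|[|n]]] //.
  by rewrite walk0 => /eqP exy; rewrite exy eqxx in xy.
  by rewrite walkS => /existsP[z /andP[exz]]; rewrite walk0 => /eqP <-.
rewrite walkS => /existsP[z /andP[/side xz]].
rewrite walkS => /existsP[t /andP[/side zt]]; rewrite walk0 => /eqP ty.
by move: xy xz zt; rewrite ty; do 3!case: (_ \in A).
Qed.

Lemma two_sided_iso (T : finType) (A : {set T}) (e : rel T) a0 b0 :
  a0 \in A -> b0 \in ~: A -> two_sided A e ->
  isomorphic e (@complete_bipartite #|A| #|~: A|).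
Proof.
move=> a0A b0A sided.
pose f x : 'I_#|A| + 'I_#|~: A| :=
  if x \in A then inl (enum_rank_in a0A x) else inr (enum_rank_in b0A x).
exists f; last first.
  by move=> x y; rewrite sided /f; case: (x \in A); case: (y \in A).
exists (fun i => match i with inl j => enum_val j | inr j => enum_val j end).
  move=> x; rewrite /f; case: ifP => [xA|/negbT xA]; rewrite enum_rankK_in //.
  by rewrite in_setC.
case=> j; rewrite /f; first by rewrite enum_valP enum_valK_in.
by have := enum_valP j; rewrite in_setC => /negbTE->; rewrite enum_valK_in.
Qed.

Lemma iso_two_sided (T : finType) (e : rel T) r s :
  0 < r -> 0 < s -> isomorphic e (@complete_bipartite r s) ->
  exists (A : {set T}) a0 b0, [/\ a0 \in A, b0 \notin A & two_sided A e].
Proof.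
case: r => // r; case: s => // s _ _ [f [g fK gK] ef].
exists [set x | if f x is inl _ then true else false].
exists (g (inl ord0)), (g (inr ord0)); rewrite !inE !gK; split=> // x y.
by rewrite ef !inE; case: (f x); case: (f y).
Qed.

Section TwoSided.
Variables (T : finType) (A : {set T}) (e : rel T) (a0 b0 : T).
Hypotheses (a0A : a0 \in A) (b0A : b0 \notin A) (sided : two_sided A e).

Lemma two_sided_walk2 x y : (x \in A) = (y \in A) -> walk e 2 x y.
Proof.
move=> xy; pose z := if x \in A then b0 else a0.
have zx : (x \in A) != (z \in A).
  by rewrite /z; case: ifP => _; rewrite ?a0A ?(negbTE b0A).
apply: (@walk_cons _ _ _ _ _ z); first by rewrite sided.
apply: (@walk_cons _ _ _ _ _ y); last by rewrite walk0.
by rewrite sided -xy eq_sym.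
Qed.

Lemma two_sided_walk x y : walk e (2 - e x y) x y.
Proof.
have [exy|] := boolP (e x y); last first.
  by rewrite sided negbK => /eqP /two_sided_walk2.
by apply: walk_cons exy _; rewrite walk0.
Qed.

Lemma two_sided_connected : connected e.
Proof.
by apply/forallP=> x; apply/forallP=> y; apply/walk_connect/two_sided_walk.
Qed.

(** From any vertex u, neighbours are at distance 1 and all other vertices at
   distance 2; since a swap at u does not raise the degree of u, it cannot
   lower the total distance. *)
Lemma two_sided_equilibrium : symmetric e -> sum_basic_equilibrium e.
Proof.
move=> sym_e; split=> [|u v v' euv v'u v'v]; first exact: two_sided_connected.
rewrite /cost_diff /total_dist two_sided_connected.
case: ifP => // _; rewrite -EFinN -EFinD lee_fin.
set s := swap_edge _ _ _ _.
have le_e : \sum_(w | w != u) gdist e u w <= \sum_(w | w != u) (2 - e u w).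
  by apply: leq_sum => w _; apply/gdist_le/two_sided_walk.
have le_s : \sum_(w | w != u) (2 - s u w) <= \sum_(w | w != u) gdist s u w.
  by apply: leq_sum => w; apply: gdist_ge.
have sum2 (b : T -> bool) : \sum_(w | w != u) (2 - b w) + \sum_(w | w != u) b w
    = \sum_(w | w != u) 2.
  by rewrite -big_split; apply: eq_bigr => w _ /=; case: (b w).
have := sum2 (e u); have := sum2 (s u).
have : \sum_(w | w != u) (s u w : nat) <= \sum_(w | w != u) (e u w : nat).
  apply: swap_degree => //; apply: contraTneq euv => ->.
  by rewrite sided eqxx.
by lia.
Qed.

End TwoSided.

Theorem corollary5 (T : finType) (e : rel T)
    (sym_e : symmetric e) (irr_e : irreflexive e) :
  (1 < #|T| ->
     (bipartite e /\ sum_basic_equilibrium e <->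
      exists r s : nat,
        [/\ 1 <= r, 1 <= s & isomorphic e (@complete_bipartite r s)])) /\
  (bipartite e -> sum_basic_equilibrium e -> diameter e <= 2).
Proof.
split=> [T_gt1|bip_e eq_e]; last first.
  apply/bigmax_leqP=> x _; apply/bigmax_leqP=> y _.
  exact: (bip_eq_dist_le2 sym_e irr_e eq_e.1 bip_e eq_e).
split=> [[bip_e eq_e]|[r [s [r_gt0 s_gt0 /(iso_two_sided r_gt0 s_gt0)]]]]; last first.
  case=> A [a0 [b0 [a0A b0A sided]]].
  split; last exact: (two_sided_equilibrium a0A b0A sided sym_e).
  by exists A => x y; rewrite sided.
have conn_e := eq_e.1; have [A side] := bip_e.
have sided : two_sided A e.
  apply: dist_le2_two_sided => // x y.
  exact: (bip_eq_dist_le2 sym_e irr_e conn_e bip_e eq_e).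
have [x [y [_ _ xy]]] : exists x y, [/\ x \in T, y \in T & x != y].
  by apply/card_gt1P.
have [z /par_edge exz] := dist_pred conn_e xy.
have [a [b [aA bA]]] : exists a b, a \in A /\ b \in ~: A.
  move: (side _ _ exz); have [xA zA|xA zA] := boolP (x \in A).
    by exists x, z; rewrite inE; case: (z \in A) zA.
  by exists z, x; rewrite inE; case: (z \in A) zA.
exists #|A|, #|~: A|; split; last exact: (two_sided_iso aA bA sided).
  by apply/card_gt0P; exists a.
by apply/card_gt0P; exists b.
Qed.
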